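(* Let $\mathcal{T}_n$ denote the family of all acyclic posets of size $n$. We have \begin{equation*} \operatorname{ao}(\mathcal{T}_n) = \frac{n}{\log_2 n} \, \big( 1 + o(1) \big). \end{equation*}
   Context: For a finite graph $G=(V,E)$, $\operatorname{ao}(G)$ denotes the maximum of $|U|$ over $U\subseteq V$ such that the induced subgraph $G[U]$ is a vertex-disjoint union of cliques. For a finite poset $P$, $\operatorname{ao}(P)$ denotes $\operatorname{ao}(G)$ where $G$ is the comparability graph of $P$ (two elements adjacent iff comparable); equivalently, the maximum size of a union of chains such that any two elements from different chains are incomparable. For a family $\mathcal{F}$ of posets, $\operatorname{ao}(\mathcal{F})=\min_{P\in\mathcal{F}}\operatorname{ao}(P)$. A poset is acyclic if its cover graph (elements adjacent iff one covers the other) is acyclic. *)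

(* Defs.v *)
From mathcomp Require Import all_boot all_order all_algebra.
From mathcomp Require Import boolp classical_sets reals topology normedtype
  sequences exp.

Set Implicit Arguments.
Unset Strict Implicit.
Unset Printing Implicit Defensive.

Import Order.TTheory.

(* Finite graphs are given by their adjacency relation [e : rel T]; the graphs
   used below are symmetric and irreflexive. *)
Section Graphs.
Variables (T : finType) (e : rel T).

Definition is_clique (A : {set T}) : bool :=
  [forall x in A, forall y in A, (x != y) ==> e x y].

Definition no_edge_between (A B : {set T}) : bool :=
  [forall x in A, forall y in B, ~~ e x y].

Definition induces_disjoint_cliques (U : {set T}) : bool :=
  [exists Q : {set {set T}},
    [&& finset.partition Q U,
        [forall A in Q, is_clique A] &
        [forall A in Q, forall B in Q, (A != B) ==> no_edge_between A B]]].

Definition ao_graph : nat :=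
  \max_(U : {set T} | induces_disjoint_cliques U) #|U|.

Definition acyclic_graph : Prop :=
  forall p : seq T, 2 < size p -> ~ ucycle e p.

End Graphs.

Section Posets.
Variables (d : Order.disp_t) (P : finPOrderType d).

Definition comparability_graph : rel P :=
  fun x y => (x != y) && (x >=< y)%O.

Definition ao_poset : nat := ao_graph comparability_graph.

Definition covers (x y : P) : bool :=
  (y < x)%O && ~~ [exists z : P, (y < z)%O && (z < x)%O].

Definition cover_graph : rel P := fun x y => covers x y || covers y x.

Definition acyclic_poset : Prop := acyclic_graph cover_graph.

End Posets.

Definition poset_family := forall d : Order.disp_t, finPOrderType d -> Prop.

(* The value on the empty set is a dummy; see [nat_minP]. *)
Definition nat_min (A : set nat) : nat :=
  if pselect (exists m, `[< A m >]) is left exA then ex_minn exA else 0.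

Lemma nat_minP (A : set nat) : (exists m, A m) ->
  A (nat_min A) /\ (forall m, A m -> nat_min A <= m).
Proof.
move=> [m Am]; rewrite /nat_min; case: pselect => [exA|[]].
  by case: ex_minnP => k /asboolP Ak kmin; split=> // j /asboolP; apply: kmin.
by exists m; apply/asboolP.
Qed.

Definition ao_family (F : poset_family) : nat :=
  nat_min (fun m => exists (d : Order.disp_t) (P : finPOrderType d),
    F d P /\ ao_poset P = m).

Definition acyclic_posets_of_size (n : nat) : poset_family :=
  fun d P => #|P| = n /\ acyclic_poset P.

Lemma acyclic_posets_of_size_inhabited (n : nat) :
  exists (d : Order.disp_t) (P : finPOrderType d), acyclic_posets_of_size n P.
Proof.
exists _, 'I_n; split; first exact: card_ord.
have cov (x y : 'I_n) : cover_graph x y -> (y == x.+1 :> nat) || (x == y.+1 :> nat).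
  wlog: x y / covers y x => [hw|].
    by case/orP=> h; [rewrite orbC|]; apply: hw; rewrite /cover_graph h ?orbT.
  case/andP => xy' /existsPn nz _; apply/orP; left.
  have xy : x < y := xy'.
  rewrite eqn_leq xy andbT leqNgt; apply/negP => xy1.
  have x1n : x.+1 < n by exact: ltn_trans xy1 (ltn_ord y).
  have xz : (x < Ordinal x1n)%O by exact: ltnSn x.
  have zy : (Ordinal x1n < y)%O by exact: xy1.
  by move: (nz (Ordinal x1n)); rewrite xz zy.
move=> p sp /andP[cp up].
have p0 : 0 < size p by exact: ltn_trans sp.
have [x0 x0p] : exists x, x \in p.
  by case: p p0 {sp cp up} => // x s _; exists x; rewrite mem_head.
case: (@arg_maxnP _ x0 (fun x => x \in p) (fun x => nat_of_ord x) x0p) => x xp xmax.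
have nb y : y \in p -> cover_graph x y || cover_graph y x -> x = y.+1 :> nat.
  move=> yp; have yx : y <= x := xmax y yp.
  by case/orP=> /cov /orP[] /eqP // E; move: yx; rewrite E ltnn.
have nx := next_cycle cp xp; have px := prev_cycle cp xp.
have En := nb _ (etrans (mem_next p x) xp) (introT orP (or_introl nx)).
have Ep := nb _ (etrans (mem_prev p x) xp) (introT orP (or_intror px)).
have /val_inj E : val (next p x) = val (prev p x).
  by apply: succn_inj; rewrite -En -Ep.
have E2 : next p (next p x) = x by rewrite E next_prev.
case/rot_to: xp => i s ps.
have us : uniq (x :: s) by rewrite -ps rot_uniq.
have ss : size s = (size p).-1 by rewrite -(size_rot i p) ps.
move: E2; rewrite -(next_rot i up) -[in X in next _ X](next_rot i up) ps.
case: s us ss {ps} => [|a [|b s]] us ss; try by move: sp; rewrite -(prednK p0) -ss.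
have [xa xb ab] : [/\ x != a, x != b & a != b].
  move: us; rewrite /= !inE !negb_or => /andP[/and3P[-> -> _]].
  by case/andP=> /andP[->].
by rewrite /= eqxx eq_sym (negPf xa) eqxx => /eqP; rewrite eq_sym (negPf xb).
Qed.

Definition log2 (R : realType) (x : R) : R := (ln x / ln 2)%R.

(* Main.v *)
(* Lower bound.  Peeling leaves off the cover graph of an acyclic poset splits the
   poset into a part whose principal down-sets are chains and a part whose
   principal up-sets are chains: a maximal leaf joins the first part, a minimal
   one the second.  A forest in which all families of pairwise incomparable
   chains have at most [m] elements has at most [m + (m / 2) log2 m] elements;
   this is an induction over disjoint unions that uses the entropy inequality
   [2 min(a, b) + a log2 a + b log2 b <= (a + b) log2 (a + b)].  Hence
   [n <= m (2 + log2 m)].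

   Upper bound.  In the complete binary tree of depth [k], replace the nodes at
   height [j < k] by chains of [s * 2 ^ j] elements.  The tree has about
   [s k 2^k] elements, height at most [s 2^k], and any family of pairwise
   incomparable chains has at most [2 s 2^k] elements.  Gluing the tree upside
   down below itself doubles the number of elements and the height but not the
   bound [2 s 2^k], because a family that meets both halves is a single chain. *)

Require Import Defs.
From HB Require Import structures.
From mathcomp Require Import boolp classical_sets reals topology normedtype
  sequences exp convex interval_inference.
From mathcomp Require Import all_boot all_order all_algebra.
From mathcomp Require Import zify ring lra.

Set Implicit Arguments.
Unset Strict Implicit.
Unset Printing Implicit Defensive.

Import Order.TTheory GRing.Theory Num.Theory.

(** * Unions of cliques as graphs without an induced path on three vertices *)

Definition P3_free (T : finType) (e : rel T) (U : {set T}) : Prop :=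
  {in U & &, forall x y z, x != z -> e x y -> e y z -> e x z}.

Section Clusters.
Variables (T : finType) (e : rel T).
Hypothesis e_sym : symmetric e.

(** Both sides amount to equality-or-adjacency being an equivalence relation on [U], with the
    cliques as its classes. *)
Lemma induces_disjoint_cliquesP (U : {set T}) :
  reflect (P3_free e U) (induces_disjoint_cliques e U).
Proof.
apply: (iffP existsP) => [[Q /and3P[pQ clQ neQ]] x y z xU yU zU xz xy yz|clU].
  have /and3P[/eqP covQ trQ _] := pQ.
  have blk t : t \in U -> pblock Q t \in Q by rewrite -covQ; apply: pblock_mem.
  have in_blk t : t \in U -> t \in pblock Q t by rewrite -covQ mem_pblock.
  have eblk s t : s \in U -> t \in U -> e s t -> pblock Q s = pblock Q t.
    move=> sU tU st; apply/eqP/negPn/negP => ne.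
    move: neQ => /forall_inP/(_ _ (blk _ sU))/forall_inP/(_ _ (blk _ tU)).
    rewrite ne /= => /forall_inP/(_ _ (in_blk _ sU))/forall_inP.
    by move/(_ _ (in_blk _ tU)); rewrite st.
  move: clQ => /forall_inP/(_ _ (blk _ xU))/forall_inP/(_ _ (in_blk _ xU)).
  move=> /forall_inP/(_ z); rewrite (eblk x y) // (eblk y z) // in_blk // xz.
  by apply.
pose R := [rel x y | (x == y) || e x y].
have eqvR : {in U & &, equivalence_rel R}.
  have tr x y z : x \in U -> y \in U -> z \in U -> R x y -> R y z -> R x z.
    move=> xU yU zU /predU1P[-> //|xy] /predU1P[<-|yz]; first by rewrite /= xy orbT.
    by rewrite /=; case: eqVneq => //= xz; apply: clU yz.
  have sy x y : R x y = R y x by rewrite /= eq_sym e_sym.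
  move=> x y z xU yU zU; split; first by rewrite /= eqxx.
  move=> xy; apply/idP/idP; last exact: tr.
  by apply: tr; rewrite // sy.
have pP := equivalence_partitionP eqvR; have /and3P[/eqP cov tr _] := pP.
exists (equivalence_partition R U); apply/and3P; split=> //.
  apply/forall_inP => A AQ; apply/forall_inP => x xA; apply/forall_inP => y yA.
  have AU z : z \in A -> z \in U.
    by move=> zA; rewrite -cov; apply/bigcupP; exists A.
  apply/implyP => xy; have := pblock_equivalence_partition eqvR (AU _ xA) (AU _ yA).
  by rewrite (def_pblock tr AQ xA) yA /= (negPf xy) => /esym.
apply/forall_inP => A AQ; apply/forall_inP => B BQ; apply/implyP => AB.
apply/forall_inP => x xA; apply/forall_inP => y yB.
have inU C z : C \in equivalence_partition R U -> z \in C -> z \in U.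
  by move=> CQ zC; rewrite -cov; apply/bigcupP; exists C.
apply/negP => xy.
have := pblock_equivalence_partition eqvR (inU _ _ AQ xA) (inU _ _ BQ yB).
rewrite /= xy orbT (def_pblock tr AQ xA) => yA.
by move: AB; rewrite -(def_pblock tr AQ yA) -(def_pblock tr BQ yB) eqxx.
Qed.

Lemma P3_free_card_le_ao (U : {set T}) : P3_free e U -> #|U| <= ao_graph e.
Proof. by move/induces_disjoint_cliquesP; apply: leq_bigmax_cond. Qed.

Lemma ao_graph_le (m : nat) :
  (forall U : {set T}, P3_free e U -> #|U| <= m) -> ao_graph e <= m.
Proof.
by move=> le_m; apply/bigmax_leqP => U /induces_disjoint_cliquesP; apply: le_m.
Qed.

(** Otherwise a path in [A] could be prolonged at its head forever: a neighbour of the head other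
    than the second vertex is either new or closes a cycle. *)
Lemma acyclic_leaf (A : {set T}) :
    irreflexive e -> acyclic_graph e -> A != set0 ->
  exists2 v, v \in A & {in A &, forall y z, e v y -> e v z -> y = z}.
Proof.
move=> irr acy /set0Pn[x0 x0A]; apply: contrapT => noleaf.
have nbr v w : v \in A -> exists y, [/\ y \in A, e v y & y != w].
  move=> vA; apply: contrapT => no; apply: noleaf; exists v => // y z yA zA vy vz.
  have eqw t : t \in A -> e v t -> t = w.
    by move=> tA vt; apply/eqP/negPn/negP => tw; apply: no; exists t.
  by rewrite (eqw y) // (eqw z).
suff long m : exists x p, [/\ path e x p, uniq (x :: p), {subset x :: p <= A}
    & size p = m].
  have [x [p [_ up _ sp]]] := long #|T|.
  by have := max_card (mem (x :: p)); rewrite (card_uniqP up) /= sp ltnn.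
elim: m => [|m [x [p [pth up pA sp]]]].
  by exists x0, [::]; split => // y; rewrite inE => /eqP ->.
have xA : x \in A by apply: pA; rewrite mem_head.
(* [head x p] is the second vertex of the path; for empty [p] it is [x], whose exclusion is harmless
   since [e] is irreflexive. *)
have [y [yA xy yh]] := nbr x (head x p) xA.
have [yp|yp] := boolP (y \in x :: p); last first.
  exists y, (x :: p); split => //=; last 1 first.
  - by rewrite sp.
  - by rewrite e_sym xy.
  - by rewrite yp; move: up => /= ->.
  - by move=> z; rewrite inE => /predU1P[->|/pA].
move: yp; rewrite inE; case: eqVneq => [yx|_ /= yp]; first by rewrite yx irr in xy.
case: (splitPr yp) pth up yh => p1 p2; rewrite -cat_rcons cat_path -cat_cons cat_uniq.
move=> /andP[pth _] /and3P[up _ _] yh; exfalso.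
apply: (acy (x :: rcons p1 y)).
  by rewrite /= size_rcons; case: p1 yh {pth up} => //=; rewrite eqxx.
by rewrite /ucycle /= rcons_path pth last_rcons e_sym xy.
Qed.

End Clusters.

(** * Splitting an acyclic poset into two forests *)

Section Forests.
Variables (d : Order.disp_t) (P : finPOrderType d).
Implicit Types (x y z u v w : P) (A B C S U : {set P}).
Local Open Scope order_scope.

Definition down_forest A : Prop :=
  {in A & &, forall x y z, y <= x -> z <= x -> y >=< z}.

Definition up_forest A : Prop :=
  {in A & &, forall x y z, x <= y -> x <= z -> y >=< z}.

Definition pchain A : Prop := {in A &, forall x y, x >=< y}.

(* For a saturated [S], the cover relation of the subposet [S] is the
   restriction of the cover relation of [P]. *)
Definition saturated S : Prop :=
  {in S &, forall x y, x < y -> covers y x \/ exists2 z, z \in S & x < z < y}.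

Lemma comparability_graph_sym : symmetric (@comparability_graph d P).
Proof. by move=> x y; rewrite /comparability_graph eq_sym comparable_sym. Qed.

Lemma cover_graph_sym : symmetric (@cover_graph d P).
Proof. by move=> x y; rewrite /cover_graph orbC. Qed.

Lemma cover_graph_irr : irreflexive (@cover_graph d P).
Proof. by move=> x; rewrite /cover_graph /covers ltxx. Qed.

Lemma covers_lt x y : covers y x -> x < y.
Proof. by case/andP. Qed.

Lemma covers_between x y z : covers y x -> x < z -> z < y -> False.
Proof. by case/andP => _ /existsPn/(_ z) /negP h xz zy; apply: h; rewrite xz. Qed.

Lemma saturated_setT : saturated [set: P].
Proof.
move=> x y _ _ xy; have [c|] := boolP (covers y x); first by left.
rewrite /covers xy /= negbK => /existsP[z xzy]; right; exists z => //.
Qed.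

(** Induction on the number of elements strictly between [x] and [y]: cutting at an element [z] of
    [S] leaves fewer in each half. *)
Lemma saturated_covers S : saturated S ->
  {in S &, forall x y, x < y ->
    (exists u, [/\ u \in S, x <= u & covers y u]) /\
    (exists w, [/\ w \in S, w <= y & covers w x])}.
Proof.
move=> sat x y; have [n] := ubnP #|[set t | x < t < y]|.
elim: n x y => // n IH x y ltn xS yS xy.
have [c|[z zS /andP[xz zy]]] := sat x y xS yS xy.
  by split; [exists x|exists y].
have sub x' y' : x <= x' -> y' <= y -> ~~ (x' < z < y') ->
    (#|[set t | (x' < t < y')%O]| < n)%N.
  move=> xx yy nz; rewrite -ltnS; apply: leq_trans ltn; rewrite ltnS.
  apply: proper_card; apply/properP; split.
    apply/subsetP => t; rewrite !inE => /andP[x't ty'].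
    by rewrite (le_lt_trans xx x't) (lt_le_trans ty' yy).
  by exists z; rewrite inE // xz.
split.
  have [|[u [uS zu yu]] _] := IH z y _ zS yS zy; first by apply: sub; rewrite ?ltxx ?lexx ?(ltW xz).
  by exists u; split=> //; rewrite ltW // (lt_le_trans xz).
have [|_ [w [wS wz xw]]] := IH x z _ xS zS xz.
  by apply: sub; rewrite ?ltxx ?andbF ?lexx ?(ltW zy).
by exists w; split=> //; rewrite ltW // (le_lt_trans wz).
Qed.

(* In the last clause no element of [A] is below one of [B]: a leaf attached above
   an element of [B] can then join [A] without spoiling [down_forest A]. *)
Lemma saturated_forest_cover S : acyclic_poset P -> saturated S ->
  exists A B, [/\ S \subset A :|: B, A :|: B \subset S, down_forest A, up_forest B
    & {in A & B, forall x y, ~~ (x < y)}].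
Proof.
move=> acy; have [n] := ubnP #|S|; elim: n S => // n IH S ltn sat.
have [->|S0] := eqVneq S set0.
  by exists set0, set0; split=> [||x|x|x]; rewrite ?inE ?setU0 ?sub0set.
have [v vS leaf] := acyclic_leaf cover_graph_sym cover_graph_irr acy S0.
have below x y : x \in S -> y \in S -> covers v x -> covers v y -> x = y.
  by move=> xS yS vx vy; apply: leaf; rewrite // /cover_graph ?vx ?vy.
have above x y : x \in S -> y \in S -> covers x v -> covers y v -> x = y.
  by move=> xS yS vx vy; apply: leaf; rewrite // /cover_graph ?vx ?vy orbT.
(* Covers on both sides would give the leaf [v] two neighbours. So [v] is minimal or maximal in [S],
   and deleting it keeps [S] saturated. *)
have notboth x y : x \in S -> y \in S -> x < v -> v < y -> False.
  move=> xS yS xv vy.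
  have [[u [uS _ uv]] _] := saturated_covers sat xS vS xv.
  have [_ [w [wS _ vw]]] := saturated_covers sat vS yS vy.
  have E : u = w by apply: leaf; rewrite // /cover_graph ?uv ?vw ?orbT.
  by have := lt_trans (covers_lt uv) (covers_lt vw); rewrite E ltxx.
have sat' : saturated (S :\ v).
  move=> x y /setD1P[xv xS] /setD1P[yv yS] xy.
  have [|[z zS /andP[xz zy]]] := sat x y xS yS xy; first by left.
  right; exists z; last by rewrite xz.
  rewrite !inE zS andbT; apply/eqP => E; rewrite E in xz zy; exact: (notboth x y).
have ltn' : #|S :\ v| < n by move: ltn; rewrite (cardsD1 v S) vS.
have [A [B [SAB ABS fA fB AB]]] := IH _ ltn' sat'.
have AS x : x \in A -> x \in S.
  by move=> xA; have := subsetP ABS x; rewrite !inE xA => /(_ isT)/andP[].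
have BS x : x \in B -> x \in S.
  by move=> xB; have := subsetP ABS x; rewrite !inE xB orbT => /(_ isT)/andP[].
have [[x0 x0S x0v]|nobelow] := pselect (exists2 x, x \in S & x < v).
  have noabove y : y \in S -> v < y -> False by move=> yS; apply: notboth x0v.
  (* Here [v] is maximal in [S] and joins [A]. Its only neighbour [u] lies above every element of
     [S] strictly below [v]. *)
  have [[u [uS _ uv]] _] := saturated_covers sat x0S vS x0v.
  have leu y : y \in S -> y < v -> y <= u.
    move=> yS yv; have [[u' [u'S yu' u'v]] _] := saturated_covers sat yS vS yv.
    by rewrite (below u u').
  exists (v |: A), B; split => //.
  - apply/subsetP => x xS; rewrite !inE; case: eqVneq => //= xv.
    by have := subsetP SAB x; rewrite !inE xv xS => /(_ isT).
  - apply/subsetP => x; rewrite !inE -orbA => /or3P[/eqP->//|/AS|/BS] //.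
  - have chv y z : y \in A -> z \in A -> y <= u -> z <= u -> y >=< z.
      move=> yA zA yu zu.
      have /subsetP/(_ u) := SAB; rewrite !inE uS andbT.
      case: eqVneq => [uE|_ /(_ isT) /orP[uA|uB]].
      + by have := covers_lt uv; rewrite uE ltxx.
      + exact: (fA u).
      have atu t : t \in A -> t <= u -> t = u.
        by move=> tA; rewrite le_eqVlt (negPf (AB t u tA uB)) orbF => /eqP.
      by rewrite (atu y) // (atu z) // comparablexx.
    have leSv x : x \in S -> v <= x -> x = v.
      by move=> xS; rewrite le_eqVlt => /predU1P[//|/(noabove _ xS)].
    have eqlt t : t \in v |: A -> t <= v -> t = v \/ t \in A /\ t <= u.
      rewrite !inE; case: eqVneq => [|tv /= tA tv']; [by left|right].
      by split=> //; apply: leu; [apply: AS|rewrite lt_neqAle tv].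
    move=> x y z xA yA zA yx zx.
    have /setU1P[E|xA'] := xA.
      subst x; case: (eqlt y yA yx) => [->|[yA' yu]]; first by rewrite comparable_sym le_comparable.
      case: (eqlt z zA zx) => [->|[zA' zu]]; first by rewrite le_comparable.
      exact: chv.
    have inA t : t \in v |: A -> t <= x -> t \in A.
      case/setU1P => // -> vx; by rewrite -(leSv x) // AS.
    by apply: (fA x) => //; apply: inA.
  - move=> x y /setU1P[->|xA] yB; last exact: AB.
    by apply/negP; apply: noabove; apply: BS.
(* A minimal [v], isolated or not, joins [B] by the mirrored argument. *)
have noB x : x \in S -> x < v -> False by move=> xS xv; apply: nobelow; exists x.
exists A, (v |: B); split => //.
- apply/subsetP => x xS; rewrite !inE; case: eqVneq => //= xv; rewrite ?orbT //.
  by have := subsetP SAB x; rewrite !inE xv xS => /(_ isT).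
- by apply/subsetP => x; rewrite !inE => /or3P[/AS|/eqP->|/BS].
- have leSv x : x \in S -> x <= v -> x = v.
    by move=> xS; rewrite le_eqVlt => /predU1P[//|/(noB _ xS)].
  move=> x y z xB yB zB xy xz.
  have /setU1P[E|xB'] := xB; last first.
    have inB t : t \in v |: B -> x <= t -> t \in B.
      by case/setU1P => // -> vx; rewrite -(leSv x) // BS.
    by apply: (fB x) => //; apply: inB.
  subst x; have [->|yv] := eqVneq y v; first by rewrite le_comparable.
  have [->|zv] := eqVneq z v; first by rewrite comparable_sym le_comparable.
  have yB' : y \in B by move: yB; rewrite !inE (negPf yv).
  have zB' : z \in B by move: zB; rewrite !inE (negPf zv).
  have vy : v < y by rewrite lt_neqAle eq_sym yv.
  have vz : v < z by rewrite lt_neqAle eq_sym zv.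
  have [_ [w [wS wy vw]]] := saturated_covers sat vS (BS _ yB') vy.
  have [_ [w' [w'S wz vw']]] := saturated_covers sat vS (BS _ zB') vz.
  rewrite (above w' w) // in wz.
  have /subsetP/(_ w) := SAB; rewrite !inE wS andbT.
  case: eqVneq => [wE|_ /(_ isT) /orP[wA|wB]].
  + by have := covers_lt vw; rewrite wE ltxx.
  + have atw t : t \in B -> w <= t -> t = w.
      by move=> tB; rewrite le_eqVlt (negPf (AB w t wA tB)) orbF => /eqP.
    by rewrite (atw y) // (atw z) // comparablexx.
  + exact: (fB w).
- move=> x y xA /setU1P[->|yB]; last exact: AB.
  by apply/negP; apply: noB; apply: AS.
Qed.

Lemma acyclic_forest_cover : acyclic_poset P ->
  exists A B, [/\ A :|: B = [set: P], down_forest A & up_forest B].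
Proof.
move=> acy; have [A [B [AB _ fA fB _]]] := saturated_forest_cover acy saturated_setT.
by exists A, B; split=> //; apply/eqP; rewrite -subTset.
Qed.

End Forests.

(** * The binary logarithm and an entropy inequality *)

Section Log2.
Variable R : realType.
Implicit Types x y t : R.
Local Open Scope ring_scope.

Lemma ln2_gt0 : 0 < ln 2 :> R.
Proof. by apply: ln_gt0; lra. Qed.

Lemma log2_2 : log2 2 = 1 :> R.
Proof. by rewrite /log2 divff // gt_eqF // ln2_gt0. Qed.

Lemma log2D x y : 0 < x -> 0 < y -> log2 (x * y) = log2 x + log2 y.
Proof. by move=> x0 y0; rewrite /log2 lnM ?posrE // mulrDl. Qed.

Lemma log2X (n : nat) : log2 (2 ^+ n) = n%:R :> R.
Proof.
by rewrite /log2 lnXn // mulrnAl divff // gt_eqF // ln2_gt0.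
Qed.

Lemma ler_log2 x y : 0 < x -> x <= y -> log2 x <= log2 y.
Proof.
move=> x0 xy; rewrite ler_wpM2r ?invr_ge0 ?(ltW ln2_gt0) // ler_ln // posrE //.
exact: lt_le_trans xy.
Qed.

Lemma log2_ge0 x : 1 <= x -> 0 <= log2 x.
Proof. by move=> x1; apply: divr_ge0; [apply: ln_ge0|apply: ltW; apply: ln2_gt0]. Qed.

(** Concavity keeps [ln] above its chord between 1 and 2. *)
Lemma log2_ge_chord t : 0 <= t <= 1 -> t <= log2 (1 + t).
Proof.
move=> /andP[t0 t1]; rewrite ler_pdivlMr ?ln2_gt0 //.
have := @concave_ln R (Itv01 t0 t1) 2 1 (ltr0Sn _ 1) ltr01.
rewrite !convRE /= ln1 mulr0 addr0.
by congr (_ <= ln _); rewrite /unstable.onem; lra.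
Qed.

(* The entropy inequality [H(y / (x + y)) >= 2 y / (x + y)]. *)
Lemma xlog2_superadditive x y : 0 < y -> y <= x ->
  2 * y + x * log2 x + y * log2 y <= (x + y) * log2 (x + y).
Proof.
move=> y0 yx; have x0 : 0 < x by lra.
have Ex : x + y = x * (1 + y / x) by field; rewrite gt_eqF.
have Ey : y + y <= x + y by lra.
have t01 : 0 <= y / x <= 1 by apply/andP; split; [apply: divr_ge0; apply: ltW|rewrite ler_pdivrMr // mul1r].
(* The chord bound at [y / x] compares [log2 x] with [log2 (x + y)]; for [log2 y], [2 * y <= x + y]
   suffices. *)
have lx : log2 x + y / x <= log2 (x + y).
  by rewrite Ex log2D ?lerD2l ?log2_ge_chord //; case/andP: t01; lra.
have ly : log2 y + 1 <= log2 (x + y).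
  rewrite -log2_2 -log2D //; apply: ler_log2; first lra.
  by move: Ey; lra.
have := ler_wpM2l (ltW x0) lx; have := ler_wpM2l (ltW y0) ly.
have -> : x * (log2 x + y / x) = x * log2 x + y by field; rewrite gt_eqF.
lra.
Qed.

End Log2.

(** * Lower bound: the size of a forest in terms of [ao_poset] *)

Section ForestBound.
Variables (d : Order.disp_t) (P : finPOrderType d) (R : realType).
Implicit Types (x y z : P) (A B C U : {set P}).
Local Open Scope order_scope.

Local Notation xlog2 n := ((n%:R : R) * log2 n%:R)%R.

Lemma pchain_P3_free C : pchain C -> P3_free (@comparability_graph d P) C.
Proof. by move=> ch x y z xC _ zC xz _ _; rewrite /comparability_graph xz ch. Qed.

Lemma pchainU1 x C : (forall y, y \in C -> x <= y) -> pchain C -> pchain (x |: C).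
Proof.
move=> xC ch y z /setU1P[->|yC] /setU1P[->|zC].
- exact: comparablexx.
- exact/le_comparable/xC.
- by rewrite comparable_sym; apply/le_comparable/xC.
- exact: ch.
Qed.

Lemma P3_freeU A B : P3_free (@comparability_graph d P) A ->
    P3_free (@comparability_graph d P) B ->
    (forall x y, x \in A -> y \in B -> ~~ (x >=< y)) ->
  P3_free (@comparability_graph d P) (A :|: B).
Proof.
move=> cA cB AB.
have sep x y : x \in A -> y \in B -> comparability_graph x y -> False.
  by move=> xA yB /andP[_]; apply/negP; apply: AB.
have sep' x y : x \in A -> y \in B -> comparability_graph y x -> False.
  by rewrite comparability_graph_sym; apply: sep.
move=> x y z /setUP[xA|xB] /setUP[yA|yB] /setUP[zA|zB] xz xy yz;
  do ?[by case: (sep _ _ _ _ xy) | by case: (sep _ _ _ _ yz)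
      |by case: (sep' _ _ _ _ xy) | by case: (sep' _ _ _ _ yz)].
- exact: (cA x y z).
- exact: (cB x y z).
Qed.

Lemma xlog2_le (m n : nat) : (m <= n)%N -> (xlog2 m <= xlog2 n)%R.
Proof.
case: m => [|m] mn; first by case: n mn => [|n] _; rewrite mul0r // mulr_ge0 ?log2_ge0 ?ler1n.
by apply: ler_pM; rewrite ?ler0n ?log2_ge0 ?ler1n ?ler_nat ?ler_log2 ?ltr0n ?ler_nat.
Qed.

(** The entropy inequality in the form suited to disjoint unions: symmetric in [a] and [b], and
    valid when one of them is [0]. *)
Lemma xlog2D (a b : nat) :
  ((minn a b)%:R * 2 + xlog2 a + xlog2 b <= xlog2 (a + b)%N)%R.
Proof.
wlog ba : a b / (b <= a)%N => [hw|].
  by case/orP: (leq_total b a) => /hw //; rewrite minnC addnC addrAC.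
rewrite (minn_idPr ba); case: b ba => [|b] ba; first by rewrite addn0; lra.
have := @xlog2_superadditive R a%:R b.+1%:R; rewrite ltr0n ler_nat ba natrD.
by move=> /(_ isT isT); lra.
Qed.

(* A minimal element [x] either lies below all of [A], and then extends the
   chain, or splits [A] into the elements above [x] and the rest. *)
Lemma down_forest_P3_free A : down_forest A ->
  exists C U, [/\ pchain C, C \subset A, P3_free (@comparability_graph d P) U,
    U \subset A & (#|C| <= #|U|)%N /\ (2 * #|A|%:R <= 2 * #|C|%:R + xlog2 #|U|)%R].
Proof.
have [n] := ubnP #|A|; elim: n A => // n IH A ltn fA.
have [->|/set0Pn[x0 x0A]] := eqVneq A set0.
  exists set0, set0; split=> [x|||//|]; rewrite ?inE ?sub0set //.
  - by move=> x y z; rewrite inE.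
  - by rewrite cards0 !mulr0 mul0r addr0.
(* Strict down-sets shrink strictly when going down, so an element of [A] with the smallest one is
   minimal in [A]. *)
have [x xA xmin] := arg_minnP (fun y => #|[set z | z < y]|) x0A.
have {}xA : x \in A := xA.
have {}xmin y : y \in A -> y <= x -> y = x.
  move=> yA yx; apply/eqP/negPn/negP => ne; have lt : y < x by rewrite lt_neqAle ne.
  have := xmin y yA; rewrite leqNgt; apply/negP/negPn/proper_card/properP.
  split; first by apply/subsetP => z; rewrite !inE => /lt_trans; apply.
  by exists y; rewrite inE // ltxx.
have sub B : B \proper A -> (#|B| < n)%N.
  by move/proper_card => BA; apply: leq_trans BA _; rewrite -ltnS.
have subf B : B \subset A -> down_forest B.
  by move/subsetP => BA y z t /BA ? /BA ? /BA ?; apply: fA.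
pose A1 := [set y in A | x <= y]; pose A2 := [set y in A | ~~ (x <= y)].
have AE : A = A1 :|: A2.
  by apply/setP => y; rewrite !inE -andb_orr orbN andbT.
have [A20|A2n] := eqVneq A2 set0.
  have xle y : y \in A -> x <= y.
    by move=> yA; have /setP/(_ y) := A20; rewrite !inE yA /= => /negbFE.
  have Ap : A :\ x \proper A by rewrite properD1.
  have [C [U [chC CA clU UA [CU le]]]] := IH _ (sub _ Ap) (subf _ (proper_sub Ap)).
  have cA : #|A| = #|A :\ x|.+1 by rewrite (cardsD1 x A) xA.
  have xC : x \notin C by apply/negP => /(subsetP CA); rewrite !inE eqxx.
  have cC : #|x |: C| = #|C|.+1 by rewrite cardsU1 xC.
  have ch : pchain (x |: C).
    apply: pchainU1 => // y /(subsetP CA)/setD1P[_]; exact: xle.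
  have CA' : x |: C \subset A.
    by rewrite subUset sub1set xA (subset_trans CA) ?subD1set.
  have UA' : U \subset A by rewrite (subset_trans UA) ?subD1set.
  (* If [C] is smaller than [U], adding [x] to [C] preserves [#|C| <= #|U|]. Otherwise the extended
     chain also serves as the family. *)
  have [lt|ge] := ltnP #|C| #|U|.
    exists (x |: C), U; split=> //; rewrite cC; split=> //.
    by rewrite cA -!(addn1 #|_|) !natrD; lra.
  exists (x |: C), (x |: C); split=> //; first exact: pchain_P3_free.
  split=> //; have := @xlog2_le #|U| #|x |: C|; rewrite cC (leq_trans ge) // => /(_ isT).
  by rewrite cA -(addn1 #|A :\ x|) -[in X in (_ -> _ <= 2 * X + _)%R](addn1 #|C|) !natrD; lra.
have sA1 : A1 \subset A by apply/subsetP => y; rewrite inE => /andP[].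
have sA2 : A2 \subset A by apply/subsetP => y; rewrite inE => /andP[].
have pA1 : A1 \proper A.
  apply/properP; split=> //; have /set0Pn[y] := A2n; rewrite inE => /andP[yA xy].
  by exists y; rewrite // inE yA.
have pA2 : A2 \proper A.
  by apply/properP; split=> //; exists x; rewrite // inE lexx andbF.
have [C1 [U1 [ch1 CA1 cl1 UA1 [CU1 le1]]]] := IH _ (sub _ pA1) (subf _ sA1).
have [C2 [U2 [ch2 CA2 cl2 UA2 [CU2 le2]]]] := IH _ (sub _ pA2) (subf _ sA2).
(* If [z <= y], then [z] and [x] both lie below [y], hence are comparable, and minimality of [x]
   gives [x <= z]. *)
have inc y z : y \in A1 -> z \in A2 -> ~~ (y >=< z).
  rewrite !inE => /andP[yA xy] /andP[zA xz]; apply/negP => /orP[yz|zy].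
    by rewrite (le_trans xy yz) in xz.
  have /orP[zx|zx] := fA y z x yA zA xA zy xy; last by rewrite zx in xz.
  by rewrite (xmin z) // lexx in xz.
have dis B1 B2 : B1 \subset A1 -> B2 \subset A2 -> #|B1 :|: B2| = (#|B1| + #|B2|)%N.
  move=> s1 s2; rewrite cardsU; have -> : B1 :&: B2 = set0; last by rewrite cards0 subn0.
  apply/setP => y; rewrite !inE; apply/negP => /andP[/(subsetP s1) y1 /(subsetP s2) y2].
  by have := inc y y y1 y2; rewrite comparablexx.
have cA : #|A| = (#|A1| + #|A2|)%N by rewrite {1}AE dis.
have cU : #|U1 :|: U2| = (#|U1| + #|U2|)%N by rewrite dis.
have clU : P3_free (@comparability_graph d P) (U1 :|: U2).
  by apply: P3_freeU => // y z /(subsetP UA1) y1 /(subsetP UA2); apply: inc.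
have UA : U1 :|: U2 \subset A.
  by rewrite subUset (subset_trans UA1) // (subset_trans UA2).
have xl := xlog2D #|U1| #|U2|.
(* The longer chain is kept; the length of the discarded one is at most the [minn] term of
   [xlog2D]. *)
have [C12|C21] := leqP #|C1| #|C2|.
  exists C2, (U1 :|: U2); split=> //; first exact: subset_trans sA2.
  rewrite cU; split; first by rewrite (leq_trans CU2) // leq_addl.
  have : (#|C1|%:R <= (minn #|U1| #|U2|)%:R :> R)%R.
    by rewrite ler_nat leq_min CU1 (leq_trans C12).
  by rewrite cA natrD; lra.
exists C1, (U1 :|: U2); split=> //; first exact: subset_trans sA1.
rewrite cU; split; first by rewrite (leq_trans CU1) // leq_addr.
have : (#|C2|%:R <= (minn #|U1| #|U2|)%:R :> R)%R.
  by rewrite ler_nat leq_min CU2 andbT (leq_trans (ltnW C21)).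
by rewrite cA natrD; lra.
Qed.

Lemma down_forest_card A : down_forest A ->
  (2 * #|A|%:R <= 2 * (ao_poset P)%:R + xlog2 (ao_poset P))%R.
Proof.
move=> /down_forest_P3_free[C [U [_ _ clU _ [CU le]]]].
have Um := P3_free_card_le_ao (@comparability_graph_sym d P) clU.
have Cm : (#|C|%:R <= (ao_poset P)%:R :> R)%R by rewrite ler_nat (leq_trans CU).
by have := xlog2_le Um; rewrite -/(ao_poset P); lra.
Qed.

End ForestBound.

Lemma ao_poset_dual (d : Order.disp_t) (P : finPOrderType d) :
  ao_poset (Order.dual P : finPOrderType _) = ao_poset P.
Proof.
congr ao_graph; apply/funext => x; apply/funext => y.
by rewrite /comparability_graph /Order.comparable orbC.
Qed.

(** The two forests contribute equal bounds; the up-forest is a down-forest of the dual, which has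
    the same [ao_poset]. *)
Lemma acyclic_poset_card (R : realType) (d : Order.disp_t) (P : finPOrderType d) :
  acyclic_poset P ->
  (#|P|%:R <= (ao_poset P)%:R * (2 + log2 (ao_poset P)%:R) :> R)%R.
Proof.
move=> /acyclic_forest_cover[A [B [AB fA fB]]].
have lA := down_forest_card R fA.
have lB : (2 * #|B|%:R <= 2 * (ao_poset P)%:R
    + (ao_poset P)%:R * log2 (ao_poset P)%:R :> R)%R.
  have fB' : @down_forest _ (Order.dual P : finPOrderType _) B.
    move=> x y z xB yB zB yx zx; have := fB x y z xB yB zB yx zx.
    by rewrite /Order.comparable orbC.
  by have := down_forest_card R fB'; rewrite ao_poset_dual.
have : (#|P|%:R <= #|A|%:R + #|B|%:R :> R)%R.
  by rewrite -natrD ler_nat -cardsT -AB cardsU leq_subr.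
lra.
Qed.

(* A cycle visits a vertex of maximal rank, whose two neighbours on the cycle
   would be equal. *)
Lemma acyclic_of_rank (T : finType) (e : rel T) (rho : T -> nat) :
    symmetric e ->
    (forall x y z, e x y -> e x z -> rho y <= rho x -> rho z <= rho x -> y = z) ->
  acyclic_graph e.
Proof.
move=> e_sym uniq_nbr p sp /andP[cp up].
have [x0 x0p] : exists x, x \in p.
  by case: p sp {cp up} => // x s _; exists x; rewrite mem_head.
case: (@arg_maxnP _ x0 (fun x => x \in p) rho x0p) => x xp xmax.
have [i s ps] := rot_to xp.
have {}xmax y : y \in s -> rho y <= rho x.
  by move=> ys; apply: xmax; rewrite /= -(mem_rot i) ps inE ys orbT.
have {sp}ss : 1 < size s by move: sp; rewrite -(size_rot i) ps.
move: cp up; rewrite -(rot_cycle i) -(rot_uniq i) ps /=.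
case: s ss xmax {ps} => [|a [|b s]] //= _ xmax; rewrite rcons_path.
case/and4P => xa _ _ lx /and3P[_ abs _].
have ls : last b s \in b :: s := mem_last b s.
suff E : a = last b s by rewrite E ls in abs.
by apply: (uniq_nbr x); rewrite ?xmax // ?inE ?eqxx // ?[e x _]e_sym //= -in_cons ls orbT.
Qed.

(* [doubled F r] is the ordinal sum of the dual of [F] (elements [(false, x)])
   and [F] (elements [(true, x)]), together with [r] isolated points. *)
Definition doubled (d : Order.disp_t) (F : finPOrderType d) (r : nat) : Type :=
  ((bool * F) + 'I_r)%type.

(** * Gluing a tree upside down below itself *)

Section Doubled.
Variables (d : Order.disp_t) (F : finPOrderType d) (r : nat).
Local Open Scope order_scope.

HB.instance Definition _ := Finite.on (doubled F r).

Definition doubled_le (u v : doubled F r) : bool :=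
  match u, v with
  | inl (true, x), inl (true, y) => x <= y
  | inl (false, x), inl (false, y) => y <= x
  (* Only elements of different copies reach this case; the dual copy lies below. *)
  | inl (b, _), inl (_, _) => ~~ b
  | inr i, inr j => i == j
  | _, _ => false
  end.

Lemma doubled_le_refl : reflexive doubled_le.
Proof. by case=> [[[] x]|i] /=. Qed.

Lemma doubled_le_anti : antisymmetric doubled_le.
Proof.
case=> [[[] x]|i] [[[] y]|j] //=.
- by move/le_anti ->.
- by rewrite andbC => /le_anti ->.
- by case/andP => /eqP ->.
Qed.

Lemma doubled_le_trans : transitive doubled_le.
Proof.
case=> [[[] x]|i] [[[] y]|j] [[[] z]|k] //=.
- exact: le_trans.
- by move=> yx xz; apply: le_trans yx.
- by move=> /eqP ->.
Qed.

HB.instance Definition _ := Order.Le_isPOrder.Build d (doubled F r)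
  doubled_le_refl doubled_le_anti doubled_le_trans.

Lemma doubled_comparableE b (x y : F) :
  comparability_graph (inl (b, x) : doubled F r) (inl (b, y)) = comparability_graph x y.
Proof.
rewrite /comparability_graph; congr andb.
  by congr negb; apply/eqP/eqP => [[]|->].
by case: b; rewrite //= /Order.comparable /= [RHS]orbC.
Qed.

Lemma doubled_comparableN b (x y : F) :
  comparability_graph (inl (b, x) : doubled F r) (inl (~~ b, y)).
Proof. by rewrite /comparability_graph /Order.comparable; case: b. Qed.

(** The rank is the distance from the middle, measured by the down-set in [F]. Neighbours of no
    larger rank all lie on the side of the root, where they form a chain; being covers on the same
    side, they coincide. *)
Lemma acyclic_doubled (root : F) :
    (forall x, root <= x) -> down_forest [set: F] ->
  acyclic_poset (doubled F r).
Proof.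
move=> le_root fF.
pose rho (u : doubled F r) : nat :=
  if u is inl (_, x) then #|[set z : F | z <= x]| else 0%N.
have rho_lt b c (x y : F) : x < y -> (rho (inl (b, x)) < rho (inl (c, y)))%N.
  move=> xy; apply/proper_card/properP; split.
    by apply/subsetP => z; rewrite !inE => zx; rewrite (le_trans zx) ?ltW.
  by exists y; rewrite inE ?lexx // lt_geF.
have ltT (x y : F) : ((inl (true, x) : doubled F r) < inl (true, y)) = (x < y).
  by rewrite !lt_neqAle; congr andb; congr negb; apply/eqP/eqP => [[]|->].
have ltF (x y : F) : ((inl (false, x) : doubled F r) < inl (false, y)) = (y < x).
  by rewrite !lt_neqAle eq_sym; congr andb; congr negb; apply/eqP/eqP => [[]|->].
have rootlt x : x != root -> root < x by move=> xr; rewrite lt_neqAle eq_sym xr le_root.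
have cmp (x y z : doubled F r) : y >=< z ->
    covers x y /\ covers x z \/ covers y x /\ covers z x -> y = z.
  have [|||] // := comparableP y z; move=> yz _ [[cy cz]|[cy cz]]; exfalso.
  - exact: (covers_between cy yz (covers_lt cz)).
  - exact: (covers_between cz (covers_lt cy) yz).
  - exact: (covers_between cz yz (covers_lt cy)).
  - exact: (covers_between cy (covers_lt cz) yz).
apply: (@acyclic_of_rank _ _ rho); first exact: cover_graph_sym.
(* A lower cover in the dual copy must be the dual root, which otherwise would lie strictly
   between. *)
have dn (x : F) (y : doubled F r) : cover_graph (inl (true, x) : doubled F r) y ->
    (rho y <= rho (inl (true, x)))%N ->
    covers (inl (true, x) : doubled F r) y /\ exists2 c, y = inl c & (c.1 = true /\ c.2 <= x) \/ c = (false, root).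
  case/orP => cv le.
    split=> //; case: y cv {le} => [[[] y]|j] cv; have := ltW (covers_lt cv) => // yx.
      by exists (true, y) => //; left.
    exists (false, y) => //; right; case: (eqVneq y root) => [-> //|/rootlt yr].
    have y1 : (inl (false, y) : doubled F r) < inl (false, root) by rewrite ltF.
    have y2 : (inl (false, root) : doubled F r) < inl (true, x) by rewrite lt_neqAle.
    by case: (covers_between cv y1 y2).
  have := covers_lt cv; case: y cv le => [[[] y]|j] cv; last by move=> _ /ltW.
    by move=> + ; rewrite ltT => le /(rho_lt true true); rewrite ltnNge le.
  by move=> _ /ltW.
have up (x : F) (y : doubled F r) : cover_graph (inl (false, x) : doubled F r) y ->
    (rho y <= rho (inl (false, x)))%N ->
    covers y (inl (false, x) : doubled F r) /\ exists2 c, y = inl c & (c.1 = false /\ c.2 <= x) \/ c = (true, root).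
  rewrite /cover_graph orbC; case/orP => cv le.
    split=> //; case: y cv {le} => [[[] y]|j] cv; have := ltW (covers_lt cv) => // yx; last first.
      by exists (false, y) => //; left.
    exists (true, y) => //; right; case: (eqVneq y root) => [-> //|/rootlt yr].
    have y1 : (inl (true, root) : doubled F r) < inl (true, y) by rewrite ltT.
    have y2 : (inl (false, x) : doubled F r) < inl (true, root) by rewrite lt_neqAle.
    by case: (covers_between cv y2 y1).
  have := covers_lt cv; case: y cv le => [[[] y]|j] cv; first by move=> _ /ltW.
    by move=> + ; rewrite ltF => le /(rho_lt false false); rewrite ltnNge le.
  by move=> _ /ltW.
move=> [[[] x]|i] y z.
- move=> xy xz /(dn _ _ xy)[cy [[b y'] Ey hy]] /(dn _ _ xz)[cz [[c z'] Ez hz]].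
  apply: (cmp (inl (true, x))); last by left.
  rewrite {}Ey {}Ez; case: hy hz => [[/= -> hy]|[-> ->]] [[/= -> hz]|[-> ->]] //.
    by have := fF x y' z'; rewrite !inE => /(_ isT isT isT hy hz).
  exact: comparablexx.
- move=> xy xz /(up _ _ xy)[cy [[b y'] Ey hy]] /(up _ _ xz)[cz [[c z'] Ez hz]].
  apply: (cmp (inl (false, x))); last by right.
  rewrite {}Ey {}Ez; case: hy hz => [[/= -> hy]|[-> ->]] [[/= -> hz]|[-> ->]] //.
    have := fF x y' z'; rewrite !inE => /(_ isT isT isT hy hz).
    by rewrite /Order.comparable orbC.
  exact: comparablexx.
- have iso (t : doubled F r) : cover_graph (inr i : doubled F r) t -> False.
    case/orP => /covers_lt; rewrite lt_neqAle; case: t => [[[] t]|j] /andP[ne] //.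
      by move=> /eqP E; rewrite E eqxx in ne.
    by move=> /eqP E; rewrite E eqxx in ne.
  by move=> /iso.
Qed.

(** If [U] meets both copies, an element of one is adjacent to all of [U] in the other, so each part
    is a chain and [h + h <= m] applies. The isolated points add at most [r]. *)
Lemma ao_doubled (h m : nat) :
    (forall C : {set F}, pchain C -> (#|C| <= h)%N) ->
    (ao_poset F <= m)%N -> (h + h <= m)%N ->
  (ao_poset (doubled F r) <= m + r)%N.
Proof.
move=> hF aoF hm; apply: ao_graph_le => [|U fU]; first exact: comparability_graph_sym.
pose S b := [set x : F | (inl (b, x) : doubled F r) \in U].
have cU : (#|U| <= #|S true| + #|S false| + r)%N.
  pose im b := [set (inl (b, x) : doubled F r) | x in S b].
  have sU : U \subset (im true :|: im false) :|: [set (inr i : doubled F r) | i in [set: 'I_r]].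
    apply/subsetP => -[[b x]|i] xU; rewrite !inE; last first.
      by apply/orP; right; apply/imsetP; exists i; rewrite ?inE.
    apply/orP; left; apply/orP; case: b xU => xU; [left|right];
      by apply/imsetP; exists x; rewrite ?inE.
  apply: leq_trans (subset_leq_card sU) _; apply: leq_trans (leq_card_setU _ _) _.
  apply: leq_add; last by apply: leq_trans (leq_imset_card _ _) _; rewrite cardsT card_ord.
  apply: leq_trans (leq_card_setU _ _) _.
  by apply: leq_add; apply: leq_imset_card.
have fS b : P3_free (@comparability_graph d F) (S b).
  move=> x y z; rewrite !inE -!(@doubled_comparableE b) => xU yU zU xz.
  by apply: fU => //; apply: contra xz => /eqP[->].
have leS b : (#|S b| <= m)%N.
  apply: leq_trans aoF; apply: P3_free_card_le_ao; last exact: fS.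
  exact: comparability_graph_sym.
have chS b y : y \in S (~~ b) -> (#|S b| <= h)%N.
  rewrite inE => yU; apply: hF => x z; rewrite !inE => xU zU.
  have [->|xz] := eqVneq x z; first exact: comparablexx.
  suff : comparability_graph x z by case/andP.
  rewrite -(@doubled_comparableE b); apply: (fU _ _ _ xU yU zU).
  - by apply: contra xz => /eqP[->].
  - exact: doubled_comparableN.
  - by rewrite comparability_graph_sym doubled_comparableN.
apply: leq_trans cU _; rewrite leq_add2r.
have [E|/set0Pn[y yS]] := eqVneq (S true) set0; first by rewrite E cards0 add0n leS.
have [E|/set0Pn[z zS]] := eqVneq (S false) set0; first by rewrite E cards0 addn0 leS.
by apply: leq_trans hm; apply: leq_add; [apply: (chS true z)|apply: (chS false y)].
Qed.

Lemma card_doubled : #|{: doubled F r}| = (2 * #|F| + r)%N.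
Proof. by rewrite card_sum card_prod card_bool card_ord. Qed.

End Doubled.

(* The elements at distance [t] from the leaf end of the tree [dyadic_tree s k]
   own blocks of [block s t] consecutive leaves among [2 ^ k]; the second
   coordinate is the index of the block.  The binary tree of depth [k] has its
   node at height [j] replaced by a chain of [s * 2 ^ j] elements, except that
   the root stays a single element. *)
Definition block (s t : nat) : nat := 2 ^ trunc_log 2 (t %/ s).+1.

Definition dyadic_tree (s k : nat) : Type :=
  {x : 'I_(s * (2 ^ k - 1)).+1 * 'I_(2 ^ k) | x.2 * block s x.1 < 2 ^ k}.

Lemma block_gt0 s t : 0 < block s t.
Proof. by rewrite expn_gt0. Qed.

(** Rounding down to a multiple of [p] never crosses a multiple of [q]. This makes blocks nested. *)
Lemma divnK_divn a p q : p %| q -> (a %/ p * p) %/ q = a %/ q.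
Proof.
case/dvdnP => c ->; have [->|p0] := posnP p; first by rewrite !muln0 !divn0.
by rewrite [c * p]mulnC !divnMA mulnK.
Qed.

Lemma block_dvd s t t' : t <= t' -> block s t %| block s t'.
Proof. by move=> tt'; rewrite dvdn_exp2l // leq_trunc_log // ltnS leq_div2r. Qed.

Lemma card_ord_lt n m : m <= n -> #|[pred i : 'I_n | i < m]| = m.
Proof. by move=> mn; rewrite -sum1_card big_ord_narrow // sum1_card card_ord. Qed.

(** * The weighted binary tree *)

Section DyadicTree.
Variables s k : nat.
Implicit Types x y z : dyadic_tree s k.

HB.instance Definition _ := Finite.on (dyadic_tree s k).

Let ht x : 'I_(s * (2 ^ k - 1)).+1 := (val x).1.
Let idx x : nat := (val x).2.
Let bl x : nat := block s (ht x).

(** The root is the bottom: [x] is at least as far from the leaf end as [y], and its block contains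
    the first leaf of the block of [y]. *)
Definition dyadic_le x y : bool := (ht y <= ht x) && ((idx y * bl y) %/ bl x == idx x).

Lemma dyadic_eq x y : ht x = ht y -> idx x = idx y -> x = y.
Proof.
move=> tt ii; apply/val_inj; rewrite [val x]surjective_pairing [val y]surjective_pairing.
by congr pair => //; apply/val_inj.
Qed.

Lemma dyadic_le_refl : reflexive dyadic_le.
Proof. by move=> x; rewrite /dyadic_le leqnn mulnK ?block_gt0 /=. Qed.

Lemma dyadic_le_anti : antisymmetric dyadic_le.
Proof.
move=> x y /andP[/andP[yx /eqP ixy] /andP[xy _]].
have tt : ht x = ht y by apply/val_inj/eqP; rewrite eqn_leq xy.
by apply: dyadic_eq => //; rewrite -ixy /bl tt mulnK ?block_gt0.
Qed.

Lemma dyadic_le_trans : transitive dyadic_le.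
Proof.
move=> y x z /andP[yx /eqP ix] /andP[zy /eqP iy]; rewrite /dyadic_le (leq_trans zy) //=.
by rewrite -ix -iy divnK_divn // block_dvd.
Qed.

HB.instance Definition _ := Order.Le_isPOrder.Build (Order.Disp tt tt) (dyadic_tree s k)
  dyadic_le_refl dyadic_le_anti dyadic_le_trans.

Lemma dyadic_leE x y :
  (x <= y)%O = (ht y <= ht x) && ((idx y * bl y) %/ bl x == idx x).
Proof. by []. Qed.

(* Two blocks that share the leaf [l] are nested. *)
Lemma dyadic_le_leaf (l : nat) x y :
  l %/ bl x = idx x -> l %/ bl y = idx y -> ht y <= ht x -> (x <= y)%O.
Proof.
by move=> lx ly yx; rewrite dyadic_leE yx -lx -ly divnK_divn ?eqxx // block_dvd.
Qed.

(** The blocks of [y] and [z] share the first leaf of the block of [x]. *)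
Lemma down_forest_dyadic : down_forest [set: dyadic_tree s k].
Proof.
move=> x y z _ _ _; rewrite !dyadic_leE => /andP[_ /eqP yx] /andP[_ /eqP zx].
apply/orP; have [yz|/ltnW zy] := leqP (ht z) (ht y); [left|right];
  exact: (@dyadic_le_leaf (idx x * bl x)).
Qed.

Lemma dyadic_chain_inj (C : {set dyadic_tree s k}) : pchain C -> {in C &, injective ht}.
Proof.
move=> ch x y xC yC tt; apply/le_anti.
by case/orP: (ch x y xC yC); rewrite !dyadic_leE /bl tt leqnn !mulnK ?block_gt0 //=
  => /eqP ->; rewrite eqxx.
Qed.

Lemma dyadic_chain_card (C : {set dyadic_tree s k}) :
  pchain C -> #|C| <= (s * (2 ^ k - 1)).+1.
Proof.
by move/dyadic_chain_inj/card_in_imset <-; rewrite -[X in _ <= X]card_ord max_card.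
Qed.

Hypothesis s_gt0 : 0 < s.

Lemma trunc_log_div_le (t : 'I_(s * (2 ^ k - 1)).+1) : trunc_log 2 (t %/ s).+1 <= k.
Proof.
have lt : t <= s * (2 ^ k - 1) by rewrite -ltnS ltn_ord.
have le : (t %/ s).+1 <= 2 ^ k.
  have := leq_div2r s lt; rewrite mulKn //.
  by have : 0 < 2 ^ k; rewrite ?expn_gt0 //; lia.
by apply: leq_trans (leq_trunc_log 2 le) _; rewrite trunc_expnK.
Qed.

(** At the largest first coordinate a single block covers all [2 ^ k] leaves. *)
Lemma dyadic_root : exists root : dyadic_tree s k, forall x, (root <= x)%O.
Proof.
have bk : block s (s * (2 ^ k - 1)) = 2 ^ k.
  by rewrite /block mulKn // subn1 prednK ?expn_gt0 // trunc_expnK.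
have k0 : 0 < 2 ^ k by rewrite expn_gt0.
have r0 : (ord_max : 'I_(s * (2 ^ k - 1)).+1, Ordinal k0).2 *
    block s (ord_max : 'I_(s * (2 ^ k - 1)).+1, Ordinal k0).1 < 2 ^ k by [].
exists (exist _ (ord_max, Ordinal k0) r0) => x.
rewrite dyadic_leE /bl /ht /idx /= bk leq_ord divn_small //.
exact: (valP x).
Qed.

Lemma card_leaves x : #|[set l : 'I_(2 ^ k) | l %/ bl x == idx x]| >= bl x.
Proof.
have blk : bl x %| 2 ^ k by rewrite dvdn_exp2l // trunc_log_div_le.
(* Block lengths divide [2 ^ k], so a block that starts among the leaves is not truncated. *)
have lt : (idx x).+1 * bl x <= 2 ^ k.
  have := valP x; rewrite /= -/(idx x) -/(ht x) -/(bl x).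
  by case/dvdnP: blk => c ->; rewrite ltn_pmul2r ?block_gt0 // leq_pmul2r ?block_gt0.
have ltk (i : 'I_(bl x)) : idx x * bl x + i < 2 ^ k.
  by apply: leq_trans lt; rewrite mulSn addnC ltn_add2r.
pose f (i : 'I_(bl x)) : 'I_(2 ^ k) := Ordinal (ltk i).
have f_inj : injective f by move=> i j [] /addnI /val_inj.
rewrite -[X in X <= _]card_ord -cardsT -(card_imset _ f_inj); apply: subset_leq_card.
apply/subsetP => _ /imsetP[i _ ->]; rewrite inE /= divnMDl ?block_gt0 //.
by rewrite divn_small ?addn0.
Qed.

(* Each component of a [P3_free] set is a chain above its minimum [x], of size at
   most [2 * s] times the number of leaves owned by [x]. *)
Lemma ao_dyadic : ao_poset (dyadic_tree s k) <= 2 * s * 2 ^ k.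
Proof.
apply: ao_graph_le => [|U fU]; first exact: comparability_graph_sym.
pose M := [set x in U | [forall y in U, (y <= x)%O ==> (y == x)]].
pose V x := [set y in U | (x <= y)%O].
have cV x : x \in M -> #|V x| <= 2 * s * bl x.
  rewrite inE => /andP[xU _].
  have ch : pchain (V x).
    move=> y z; rewrite !inE => /andP[yU xy] /andP[zU xz].
    have [->|yz] := eqVneq y z; first exact: comparablexx.
    have [->|yx] := eqVneq y x; first exact: le_comparable.
    have [->|zx] := eqVneq z x; first by rewrite comparable_sym le_comparable.
    suff : comparability_graph y z by case/andP.
    apply: (fU y x z) => //; rewrite /comparability_graph.
      by rewrite yx comparable_sym le_comparable.
    by rewrite eq_sym zx le_comparable.
  have -> : #|V x| = #|[set ht y | y in V x]|.
    by rewrite card_in_imset //; apply: dyadic_chain_inj.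
  have sub : [set ht y | y in V x] \subset [set t : 'I_(s * (2 ^ k - 1)).+1 | t < (ht x).+1].
    by apply/subsetP => _ /imsetP[y + ->]; rewrite !inE dyadic_leE => /and3P[].
  apply: leq_trans (subset_leq_card sub) _.
  have -> : #|[set t : 'I_(s * (2 ^ k - 1)).+1 | t < (ht x).+1]| = (ht x).+1.
    by rewrite cardsE card_ord_lt.
  (* The factor 2 is the loss in rounding [ht x %/ s + 1] down to the power of two [bl x]. *)
  have := trunc_log_ltn (ht x %/ s).+1 (isT : 1 < 2).
  rewrite expnS -/(block s (ht x)) -/(bl x) => lt.
  have := ltn_ceil (ht x) s_gt0; nia.
have UM : U \subset \bigcup_(x in M) V x.
  apply/subsetP => y yU.
  have y0 : (y \in U) && (y <= y)%O by rewrite yU lexx.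
  have [x /andP[xU xy] xmax] := @arg_maxnP _ y
    (fun x => (x \in U) && (x <= y)%O) (fun x => ht x : nat) y0.
  apply/bigcupP; exists x; last by rewrite inE yU.
  rewrite inE xU; apply/forall_inP => z zU; apply/implyP => zx.
  have zt : ht z <= ht x by apply: xmax; rewrite zU (le_trans zx).
  move: (zx); rewrite dyadic_leE => /andP[xz /eqP iz].
  have tt : ht z = ht x by apply/val_inj/eqP; rewrite eqn_leq zt.
  by apply/eqP/dyadic_eq; rewrite // -iz /bl tt mulnK ?block_gt0.
(* Double counting of minimal elements and their leaves: two minimal elements that share a leaf are
   comparable, hence equal. *)
have sumM : \sum_(x in M) bl x <= 2 ^ k.
  apply: leq_trans (_ : \sum_(x in M) \sum_(l < 2 ^ k | l %/ bl x == idx x) 1 <= _).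
    by apply: leq_sum => x _; rewrite sum1dep_card card_leaves.
  under eq_bigr do rewrite big_mkcond /=.
  rewrite exchange_big /= -[X in _ <= X]card_ord -sum1_card; apply: leq_sum => l _.
  rewrite -big_mkcondr sum1dep_card; apply/card_le1_eqP => x y.
  rewrite !inE => /andP[/andP[xU /forall_inP xm] /eqP lx] /andP[/andP[yU /forall_inP ym] /eqP ly].
  have [yx|/ltnW xy] := leqP (ht y) (ht x).
    by have := ym x xU; rewrite (dyadic_le_leaf lx ly yx) => /eqP.
  by have := xm y yU; rewrite (dyadic_le_leaf ly lx xy) => /eqP.
apply: leq_trans (subset_leq_card UM) _.
apply: leq_trans (_ : \sum_(x in M) #|V x| <= _).
  elim/big_rec2: _ => [|x A n _ IH]; first by rewrite cards0.
  by apply: leq_trans (leq_card_setU _ _) _; rewrite leq_add2l.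
apply: leq_trans (_ : \sum_(x in M) 2 * s * bl x <= _); first exact: leq_sum.
by rewrite -big_distrr /= leq_mul2l sumM orbT.
Qed.

Lemma sum_divn (f : nat -> nat) n : \sum_(t < s * n) f (t %/ s) = s * \sum_(j < n) f j.
Proof.
elim: n => [|n IH]; first by rewrite muln0 !big_ord0 muln0.
rewrite mulnS addnC big_split_ord /= IH big_ord_recr /= mulnDr; congr addn.
under eq_bigr => i _ do rewrite mulnC divnMDl // divn_small ?addn0 //.
by rewrite sum_nat_const card_ord.
Qed.

(** Each range from [2 ^ i] to [2 ^ i.+1] has [2 ^ i] terms equal to [2 ^ (k - i)], contributing
    [2 ^ k]. *)
Lemma sum_trunc_log i : i <= k ->
  \sum_(1 <= j < 2 ^ i) 2 ^ (k - trunc_log 2 j) = i * 2 ^ k.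
Proof.
elim: i => [|i IH] ik; first by rewrite big_geq.
rewrite (@big_cat_nat _ _ _ (2 ^ i)) ?expn_gt0 ?leq_exp2l //= IH ?(ltnW ik) //.
rewrite mulSn addnC; congr addn; rewrite big_nat_cond.
rewrite (eq_bigr (fun=> 2 ^ (k - i))); last first.
  by move=> j /andP[ij _]; rewrite (trunc_log_eq _ ij).
rewrite -big_nat_cond sum_nat_const_nat expnS mul2n -addnn addnK -expnD subnKC //.
exact: ltnW.
Qed.

(** There are [2 ^ k / block s t] elements with first coordinate [t], constant over runs of [s]
    values; the last value is the root and gives the successor. *)
Lemma card_dyadic : #|{: dyadic_tree s k}| = (s * k * 2 ^ k).+1.
Proof.
rewrite card_sig -sum1_card -(pair_big_dep xpredT
  (fun (t : 'I__) (b : 'I__) => b * block s t < 2 ^ k) (fun _ _ => 1)) /=.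
pose g j := 2 ^ (k - trunc_log 2 j.+1).
rewrite (eq_bigr (fun t : 'I__ => g (t %/ s))) => [|t _]; last first.
  have tk := trunc_log_div_le t.
  rewrite sum1dep_card cardsE -[RHS](@card_ord_lt (2 ^ k)) ?leq_exp2l ?leq_subr //.
  have Ek : 2 ^ k = g (t %/ s) * block s t by rewrite -expnD subnK.
  apply: eq_card => b; rewrite !inE.
  transitivity (b * block s t < 2 ^ k); first by [].
  by rewrite [X in b * _ < X]Ek ltn_pmul2r ?block_gt0.
rewrite big_ord_recr /= sum_divn mulKn // [g (_ - 1)]/g subn1 prednK ?expn_gt0 //.
rewrite trunc_expnK // subnn expn0 addn1 -mulnA -(sum_trunc_log (leqnn k)).
by rewrite big_add1 big_mkord.
Qed.

End DyadicTree.

(** * Upper bound: choice of the tree parameters *)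

Lemma ao_family_attained n :
  exists (d : Order.disp_t) (P : finPOrderType d),
    [/\ #|P| = n, acyclic_poset P
      & ao_poset P = ao_family (acyclic_posets_of_size n)].
Proof.
have [|[d [P [[cP aP] E]]] _] := @nat_minP (fun m => exists (d : Order.disp_t)
    (P : finPOrderType d), acyclic_posets_of_size n P /\ ao_poset P = m).
  have [d [P FP]] := acyclic_posets_of_size_inhabited n.
  by exists (ao_poset P), d, P.
by exists d, P.
Qed.

Lemma ao_family_le n d (P : finPOrderType d) :
  acyclic_posets_of_size n P -> ao_family (acyclic_posets_of_size n) <= ao_poset P.
Proof.
move=> FP; have [|_] := @nat_minP (fun m => exists (d : Order.disp_t)
    (P : finPOrderType d), acyclic_posets_of_size n P /\ ao_poset P = m).
  by exists (ao_poset P), d, P.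
by apply; exists d, P.
Qed.

Lemma ao_family_upper n s k : 0 < s -> 2 * (s * k * 2 ^ k).+1 <= n ->
  ao_family (acyclic_posets_of_size n)
    <= 2 * s * 2 ^ k + (n - 2 * (s * k * 2 ^ k).+1).
Proof.
move=> s0 le_n; have [root le_root] := dyadic_root k s0.
set r := n - _.
apply: leq_trans (@ao_doubled _ (dyadic_tree s k) r _ _ (@dyadic_chain_card s k)
  (ao_dyadic k s0) _).
  apply: ao_family_le; split; first by rewrite card_doubled card_dyadic // subnKC.
  exact: acyclic_doubled le_root (@down_forest_dyadic s k).
(* Two chains of maximal length fit: [2 * (s * (2 ^ k - 1)).+1 <= 2 * s * 2 ^ k] because [s] is
   positive. *)
by have : 0 < 2 ^ k; rewrite ?expn_gt0 //; nia.
Qed.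

Lemma ao_family_upper_mul n k : 0 < k -> 2 * (k * 2 ^ k).+1 <= n ->
  k * ao_family (acyclic_posets_of_size n) <= n + 2 * k ^ 2 * 2 ^ k.
Proof.
move=> k0 le_n; have K0 : 0 < 2 * (k * 2 ^ k) by rewrite !muln_gt0 k0 expn_gt0.
(* The largest [s] whose doubled tree fits into [n]; the remainder of this division is the number of
   isolated points. *)
pose s := (n - 2) %/ (2 * (k * 2 ^ k)).
have s0 : 0 < s by rewrite divn_gt0 //; lia.
have E := divn_eq (n - 2) (2 * (k * 2 ^ k)); rewrite -/s in E.
have lt := ltn_pmod (n - 2) K0.
have Es : 2 * (s * k * 2 ^ k).+1 = 2 + s * (2 * (k * 2 ^ k)) by nia.
have := @ao_family_upper n s k s0; rewrite Es => /(_ ltac:(lia)) le.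
apply: leq_trans (leq_mul (leqnn k) le) _; nia.
Qed.

Lemma sqr_le_expn2 l : 4 <= l -> l ^ 2 <= 2 ^ l.
Proof.
elim: l => // l IH; rewrite leq_eqVlt => /predU1P[<- //|]; rewrite ltnS => /[dup] l4 /IH le.
by rewrite [2 ^ _]expnS; move: le; rewrite -!mulnn; nia.
Qed.

(* With [k := L - 3 * l], the power [2 ^ k] is at most [n / (L / 2) ^ 3], which
   makes the error term [2 * k ^ 2 * 2 ^ k] of [ao_family_upper_mul] negligible. *)
Lemma ao_family_upper_log n (L := trunc_log 2 n) (l := trunc_log 2 L) : 5 <= l ->
  ao_family (acyclic_posets_of_size n) * L.+1 * l <= n * (l + 80).
Proof.
move=> l5; have L0 : 0 < L by case: (posnP L) l5 => // E; rewrite /l E trunc_log0.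
have n0 : 0 < n by case: (posnP n) L0 => // E; rewrite /L E trunc_log0.
have Ln := trunc_logP (isT : 1 < 2) n0; rewrite -/L in Ln.
have lL := trunc_logP (isT : 1 < 2) L0; rewrite -/l in lL.
have Ll := trunc_log_ltn L (isT : 1 < 2); rewrite -/l expnS in Ll.
have sq := @sqr_le_expn2 l (ltnW l5); rewrite -mulnn in sq.
set X := 2 ^ l in lL Ll sq.
set m := ao_family _; pose k := L - 3 * l.
have X32 : 32 <= X by rewrite -[32]/(2 ^ 5) leq_exp2l.
(* The subtraction is not truncated: [3 * l <= l ^ 2 <= X <= L]. *)
have kE : k + 3 * l = L.
  rewrite /k subnK //; apply: leq_trans lL.
  by move: l5 sq; case: (l) => [|[|[|[|[|l']]]]] //; nia.
have k0 : 0 < k by nia.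
have XL : 2 ^ k * X ^ 3 = 2 ^ L by rewrite -kE expnD [3 * l]mulnC expnM.
(* From [k <= 2 * X] and [2 ^ k * X ^ 3 = 2 ^ L <= n], the error term is at most [8 * n / X]. *)
have k2 : 2 * k ^ 2 * 2 ^ k * X <= 8 * n.
  apply: leq_trans (_ : 8 * (2 ^ k * X ^ 3) <= _); last by rewrite XL leq_mul2l Ln.
  have kX : k <= 2 * X by lia.
  have := leq_mul (leq_mul kX kX) (leqnn (2 ^ k * X)); rewrite -!mulnn !expnS expn0 muln1.
  by nia.
have le1 : 2 * (k * 2 ^ k).+1 <= n.
  apply: leq_trans Ln; rewrite -XL.
  have kX : k <= 2 * X by lia.
  have := expn_gt0 2 k; rewrite /= => p0.
  have : k * 2 ^ k <= 2 * X * 2 ^ k by rewrite leq_mul2r kX orbT.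
  rewrite !expnS expn0 muln1; move: (2 ^ k) p0 => Y Y0 le.
  have : X * (X * X) >= 32 * 32 * X by nia.
  nia.
have := ao_family_upper_mul k0 le1; rewrite -/m => le2.
have le3 : k * m * X <= n * (X + 8) by nia.
(* Passing from [k] to [L.+1] and from [X] to [X + 8] costs a relative error of order [1 / l], as
   [l ^ 2 <= X <= L]; the constant 80 absorbs it. *)
have key : L.+1 * (X + 8) * l <= k * X * (l + 80).
  have : 240 * l * X <= 48 * L * X by rewrite leq_mul2r; apply/orP; right; nia.
  have : 3 * (l * l) * X <= 3 * L * X by rewrite leq_mul2r; apply/orP; right; nia.
  have : l <= X by nia.
  rewrite -kE; nia.
have kX0 : 0 < k * X by rewrite muln_gt0 k0; lia.
rewrite -(leq_pmul2l kX0).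
apply: leq_trans (_ : n * (L.+1 * (X + 8) * l) <= _); last first.
  by rewrite [leqRHS]mulnCA leq_mul2l key orbT.
have := leq_mul le3 (leqnn (L.+1 * l)).
by congr (_ <= _); ring.
Qed.

(** * The asymptotic statement *)

Import numFieldNormedType.Exports.
Local Open Scope classical_set_scope.
Local Open Scope ring_scope.

Lemma ao_family_lower (R : realType) n : (0 < n)%N ->
  n%:R <= (ao_family (acyclic_posets_of_size n))%:R * (2 + log2 n%:R) :> R.
Proof.
move=> n0; have [d [P [cP aP <-]]] := ao_family_attained n.
have := acyclic_poset_card R aP; rewrite cP => le.
apply: le_trans le _; have m_n : (ao_poset P <= n)%N.
  by apply: ao_graph_le => [|U _]; [apply: comparability_graph_sym|rewrite -cP max_card].
(* Monotonicity of [log2] requires a positive argument; at [0] the left side vanishes. *)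
case: (posnP (ao_poset P)) => [->|m0]; first by rewrite !mul0r.
by rewrite ler_wpM2l ?ler0n // lerD2l ler_log2 ?ltr0n ?ler_nat.
Qed.

Lemma trunc_log_log2 (R : realType) n : (0 < n)%N ->
  (trunc_log 2 n)%:R <= log2 (n%:R : R) <= (trunc_log 2 n).+1%:R.
Proof.
move=> n0; have := trunc_log_bounds (isT : 1 < 2)%N n0 => /= /andP[lo hi].
apply/andP; split.
  by rewrite -[X in X <= _](log2X R) ler_log2 ?exprn_gt0 // -natrX ler_nat.
by rewrite -[X in _ <= X](log2X R) ler_log2 ?ltr0n // -natrX ler_nat ltnW.
Qed.

Theorem theorem1 (R : realType) :
  exists eps : nat -> R,
    eps @ \oo --> (0 : R) /\
    \forall n \near \oo,
      (ao_family (acyclic_posets_of_size n))%:R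
        = n%:R / log2 (n%:R : R) * (1 + eps n).
Proof.
pose m n : R := (ao_family (acyclic_posets_of_size n))%:R.
(* Solving the equation for [eps] leaves only its convergence to [0], through a bound by [80 / l]
   with [l] an iterated logarithm of [n]. *)
pose eps n : R := m n * log2 n%:R / n%:R - 1.
have bounds n (l := trunc_log 2 (trunc_log 2 n)) : (5 <= l)%N ->
    [/\ 0 < n%:R :> R, 0 < log2 n%:R :> R & `|eps n| <= 80 / l%:R].
  move=> l5.
  have L0 : (0 < trunc_log 2 n)%N.
    by case: (posnP (trunc_log 2 n)) l5 => // E; rewrite /l E trunc_log0.
  have n0 : (0 < n)%N by case: (posnP n) L0 => // ->; rewrite trunc_log0.
  have nR : 0 < n%:R :> R by rewrite ltr0n.
  have /andP[lo hi] := trunc_log_log2 R n0.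
  have logR : 0 < log2 n%:R :> R by apply: lt_le_trans lo; rewrite ltr0n.
  have lR : 0 < l%:R :> R by rewrite ltr0n (leq_trans _ l5).
  have m0 : 0 <= m n by rewrite ler0n.
  have lL : l%:R <= log2 n%:R :> R.
    apply: le_trans lo; rewrite ler_nat; apply: leq_trans (trunc_logP (isT : 1 < 2)%N L0).
    by rewrite ltnW // ltn_expl.
  split=> //; rewrite ler_norml; apply/andP; split.
    have low := ao_family_lower R n0.
    rewrite -/(m n) in low.
    (* Either [eps n >= 0], or [m n * l <= m n * log2 n < n]. Then the lower bound gives
       [eps n >= - 2 * m n / n >= - 2 / l]. *)
    have [ge|lt] := leP n%:R (m n * log2 n%:R).
      have : 1 <= m n * log2 n%:R / n%:R by rewrite ler_pdivlMr // mul1r.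
      have : 0 <= 80 / l%:R :> R by rewrite divr_ge0 ?ltW.
      by rewrite /eps; lra.
    have ml : m n * l%:R <= n%:R by apply: le_trans (ltW lt); rewrite ler_wpM2l.
    rewrite /eps lerBrDr ler_pdivlMr // -(ler_pM2r lR).
    have -> : (- (80 / l%:R) + 1) * n%:R * l%:R = n%:R * l%:R - 80 * n%:R :> R.
      by field; rewrite gt_eqF.
    by nra.
  have up := ao_family_upper_log l5; rewrite -/l in up.
  have {}up : m n * (trunc_log 2 n).+1%:R * l%:R <= n%:R * (l%:R + 80).
    by rewrite /m -!natrM -natrD -natrM ler_nat.
  have up2 : m n * log2 n%:R <= m n * (trunc_log 2 n).+1%:R by rewrite ler_wpM2l.
  have up3 : m n * log2 n%:R * l%:R <= n%:R * (l%:R + 80).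
    by apply: le_trans up; rewrite ler_wpM2r // ltW.
  rewrite /eps lerBlDl ler_pdivrMr // -(ler_pM2r lR); apply: le_trans up3 _.
  by have -> : (1 + 80 / l%:R) * n%:R * l%:R = n%:R * (l%:R + 80) :> R
    by field; rewrite gt_eqF.
have large N n : (2 ^ 2 ^ N <= n)%N -> (N <= trunc_log 2 (trunc_log 2 n))%N.
  by move=> le; apply: trunc_log_max => //; apply: trunc_log_max.
exists eps; split; last first.
  have [N N5] : exists N, (5 <= N)%N by exists 5%N.
  exists (2 ^ 2 ^ N)%N => // n /= /large /(leq_trans N5) /bounds[nR logR _].
  by rewrite -/(m n) /eps; field; rewrite !gt_eqF.
apply/cvgrPdist_le => e e0.
pose N := maxn 5 (Num.truncn (80 / e)).+1.
exists (2 ^ 2 ^ N)%N => // n /= /large leN.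
have [|_ _ le] := bounds n; first by apply: leq_trans leN; rewrite leq_maxl.
rewrite sub0r normrN; apply: le_trans le _.
have lt : 80 / e < (trunc_log 2 (trunc_log 2 n))%:R.
  apply: lt_le_trans (truncnS_gt _) _.
  by rewrite ler_nat; apply: leq_trans leN; rewrite leq_maxr.
rewrite ler_pdivrMr; last by apply: le_lt_trans lt; rewrite divr_ge0 // ltW.
by rewrite mulrC -ler_pdivrMr // ltW.
Qed.
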